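(* For any symmetric convex body $K \subseteq \mathbb{R}^2$ we have $d_{BM}(K, \mathbb{B}^2) < d$ or $d_{BM}(K, \mathcal{P}^2) < d$, where $d := \frac{11 \sqrt{2}}{10 + \sqrt{2}} < 1.363$.
   Context: A convex body in $\mathbb{R}^n$ is a compact convex set with non-empty interior; it is symmetric if it has a center of symmetry, i.e. some translate of it is invariant under $x\mapsto -x$. $\mathbb{B}^2$ is the closed Euclidean unit disc in $\mathbb{R}^2$ and $\mathcal{P}^2=[-1,1]^2$. The Banach-Mazur distance of convex bodies $K,L\subseteq\mathbb{R}^n$ is $d_{BM}(K,L)=\inf\{\rho>0 : K+u\subseteq T(L+v)\subseteq\rho(K+u)\}$, where the infimum is over all invertible linear operators $T:\mathbb{R}^n\to\mathbb{R}^n$ and vectors $u,v\in\mathbb{R}^n$ (it is attained, and for origin symmetric $K,L$ one may take $u=v=0$). *)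

(* Defs.v *)
From HB Require Import structures.
From mathcomp Require Import all_boot all_order all_algebra.
From mathcomp Require Import all_classical all_reals all_analysis.

Set Implicit Arguments.
Unset Strict Implicit.
Unset Printing Implicit Defensive.

Import Order.TTheory GRing.Theory Num.Theory.
Import numFieldNormedType.Exports.

Local Open Scope classical_set_scope.
Local Open Scope ring_scope.

(* R^n is 'rV[R]_n; its library topology is that of the sup norm, hence the
   usual Euclidean one. *)

Definition translate (R : realType) (n : nat) (u : 'rV[R]_n)
    (A : set 'rV[R]_n) : set 'rV[R]_n :=
  [set x + u | x in A].

Definition dilate (R : realType) (n : nat) (rho : R)
    (A : set 'rV[R]_n) : set 'rV[R]_n :=
  [set rho *: x | x in A].

Definition convex_body (R : realType) (n : nat) (K : set 'rV[R]_n) : Prop :=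
  [/\ compact K, @convex_set R 'rV[R]_n K & interior K !=set0].

Definition symmetric_body (R : realType) (n : nat) (K : set 'rV[R]_n) : Prop :=
  exists u : 'rV[R]_n, [set - x | x in translate u K] = translate u K.

Definition enorm (R : realType) (n : nat) (x : 'rV[R]_n) : R :=
  Num.sqrt (\sum_(i < n) x ord0 i ^+ 2).

Definition euclidean_ball (R : realType) (n : nat) : set 'rV[R]_n :=
  [set x | enorm x <= 1].

Definition cube (R : realType) (n : nat) : set 'rV[R]_n :=
  [set x | forall i : 'I_n, -1 <= x ord0 i <= 1].

(* The infimum is taken in \bar R, so that an empty set of admissible ratios
   gives +oo; the real-valued inf would give 0. *)
Definition BM_dist (R : realType) (n : nat) (K L : set 'rV[R]_n) : \bar R :=
  ereal_inf [set rho%:E | rho in [set rho : R | 0 < rho /\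
    exists (T : {linear 'rV[R]_n -> 'rV[R]_n}) (u v : 'rV[R]_n),
      [/\ bijective T,
          translate u K `<=` T @` translate v L
        & T @` translate v L `<=` dilate rho (translate u K)]]].

Arguments euclidean_ball : clear implicits.
Arguments cube : clear implicits.

(* Main.v *)
Require Import Defs.
From HB Require Import structures.
From mathcomp Require Import all_boot all_order all_algebra.
From mathcomp Require Import all_classical all_reals all_analysis.
From mathcomp Require Import ring lra.
Set Implicit Arguments.
Unset Strict Implicit.
Unset Printing Implicit Defensive.

Import Order.TTheory GRing.Theory Num.Theory.
Import numFieldNormedType.Exports.
Local Open Scope classical_set_scope.
Local Open Scope ring_scope.

(** The bound holds with [4 / 3 < d] in place of [d]. After centring, let [N] be
    the norm of the plane whose unit ball is [K].

    An ellipse within ratio [4 / 3] of [K] is the same as a quadratic form [q]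
    with [N ^ 2 <= q <= 16 / 9 * N ^ 2]. For each direction [(t, 1)] this
    condition cuts out a slab in the 3-dimensional space of quadratic forms, so by
    Helly's theorem ([helly_compact], [quad_between]) such a [q] exists unless the
    slabs of some four slopes [t1 < t2 < t3 < t4] have no common point. The values
    of a quadratic polynomial at four points satisfy a single linear relation,
    whose coefficients alternate in sign. Hence an obstruction consists of vectors
    [u, u'] interlaced with [v1, v2] and of positive weights such that
    [w * u u^T + w' * u' u'^T = m1 * v1 v1^T + m2 * v2 v2^T] while
    [w * N(u) ^ 2 + w' * N(u') ^ 2 >= 16 / 9 * (m1 * N(v1) ^ 2 + m2 * N(v2) ^ 2)]
    ([quad_fit4]).

    The triangle inequality allows at most the factor 2 in place of [16 / 9], and
    2 is reached only when [N] is, up to scale, the l1 norm in a basis of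
    multiples of [v1] and [v2]. A factor close to 2 therefore forces [N] to be
    close to that l1 norm: at [u] and [u'] the norm is only slightly below its l1
    value, and since [N] is convex on each edge of the l1 ball and equals 1 at the
    vertices, it stays above [3 / 4] on the whole edge ([edge_bound], [octant_bounds]). So the
    parallelogram [P] with vertices [v1 / N(v1)], [v2 / N(v2)] and their opposites
    satisfies [P <= K <= 4 / 3 * P], and [K] is within [4 / 3] of the square. *)

(** * Helly's theorem *)

Lemma convex_setP (R : realType) (V : lmodType R) (C : set V) :
  @convex_set R V C <->
  forall x y (t : R), C x -> C y -> 0 <= t <= 1 -> C (t *: x + (1 - t) *: y).
Proof.
split=> [cC x y t Cx Cy /andP[t0 t1]|cC x y t /set_mem Cx /set_mem Cy].
  have := cC x y (Itv01 t0 t1) (mem_set Cx) (mem_set Cy).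
  by rewrite inE.
rewrite inE; apply: cC => //.
by rewrite ge0 le1.
Qed.

(** The zero-weight terms are dropped one at a time, so that only the points of
    positive weight have to lie in [C], as Radon's argument requires. *)
Lemma convex_set_weighted_mean (R : realType) (V : lmodType R) (C : set V)
    (I : Type) (r : seq I) (w : I -> R) (p : I -> V) :
  @convex_set R V C -> (forall i, 0 <= w i) -> (forall i, 0 < w i -> C (p i)) ->
  0 < \sum_(i <- r) w i ->
  C ((\sum_(i <- r) w i)^-1 *: \sum_(i <- r) w i *: p i).
Proof.
move=> /convex_setP cC w0 Cp.
suff [[-> _]|[]//] : (\sum_(i <- r) w i = 0 /\ \sum_(i <- r) w i *: p i = 0) \/
  (0 < \sum_(i <- r) w i /\
   C ((\sum_(i <- r) w i)^-1 *: \sum_(i <- r) w i *: p i)).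
  by rewrite ltxx.
elim: r => [|i r IH]; first by left; rewrite !big_nil.
rewrite !big_cons; have [wi0|wi0] := eqVneq (w i) 0.
  by rewrite wi0 scale0r !add0r.
have wi : 0 < w i by rewrite lt_def wi0 w0.
right; case: IH => [[-> ->]|].
  by rewrite !addr0 scalerA mulVf// scale1r; split=> //; exact: Cp.
set W := \sum_(_ <- _) _; set S := \sum_(_ <- _) _ => -[W0 CS].
have WW : 0 < w i + W by rewrite addr_gt0.
split=> //.
have -> : (w i + W)^-1 *: (w i *: p i + S) =
    (w i / (w i + W)) *: p i + (1 - w i / (w i + W)) *: (W^-1 *: S).
  rewrite scalerDr !scalerA; congr (_ *: _ + _ *: _); first by rewrite mulrC.
  by field; rewrite !gt_eqF.
apply: cC => //; first exact: Cp.
apply/andP; split; first by rewrite divr_ge0 ?ltW.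
by rewrite ler_pdivrMr// mul1r lerDl ltW.
Qed.

(** The [n + 2] vectors [(p i, 1)] live in dimension [n + 1]. *)
Lemma affine_dependence (R : realType) (n : nat) (p : 'I_n.+2 -> 'rV[R]_n) :
  exists c : 'I_n.+2 -> R, [/\ exists i, c i != 0, \sum_i c i = 0
    & \sum_i c i *: p i = 0].
Proof.
pose A : 'M[R]_(n.+2, n + 1) := row_mx (\matrix_i p i) (const_mx 1).
have : kermx A != 0.
  rewrite kermx_eq0 /row_free; apply: contraTneq (rank_leq_col A) => ->.
  by rewrite -ltnNge addn1.
move=> /rowV0Pn[v /sub_kermxP vA v0].
exists (v 0); split.
- apply/existsP; apply: contra_neqT v0 => /existsPn c0.
  by apply/rowP => i; rewrite mxE; apply/eqP; rewrite -[_ == _]negbK c0.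
- move: vA; rewrite mul_mx_row => /(congr1 rsubmx) /matrixP/(_ 0 0).
  rewrite row_mxKr linear0 !mxE => e; rewrite -[RHS]e; apply: eq_bigr => i _.
  by rewrite mxE mulr1.
- move: vA; rewrite mul_mx_row => /(congr1 lsubmx).
  rewrite row_mxKl linear0 mulmx_sum_row => e; rewrite -[RHS]e; apply: eq_bigr => i _.
  by rewrite rowK.
Qed.

(** Helly's theorem for [n + 2] sets. Split an affine dependence of the points
    [p i], each in all sets but the [i]-th, into its positive and negative parts:
    the two parts have the same barycentre (Radon's point). The part in which
    [p i] does not occur shows that this point lies in [C i]. *)
Lemma radon_helly (R : realType) (n : nat) (C : 'I_n.+2 -> set 'rV[R]_n) :
  (forall i, @convex_set R 'rV[R]_n (C i)) ->
  (forall i, exists x, forall j, j != i -> C j x) ->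
  exists x, forall i, C i x.
Proof.
move=> cC /choice[p pC].
have [c [[k ck] sc scp]] := affine_dependence p.
pose w i := Num.max (c i) 0; pose v i := Num.max (- c i) 0.
have w0 i : 0 <= w i by rewrite le_max lexx orbT.
have v0 i : 0 <= v i by rewrite le_max lexx orbT.
have wv i : c i = w i - v i by rewrite /w /v !maxEle; have [c0|c0] := leP (c i) 0;
  have [c1|c1] := leP (- c i) 0; lra.
have sumE : \sum_i w i = \sum_i v i.
  apply/eqP; rewrite -subr_eq0 -sumrB; apply/eqP; rewrite -[RHS]sc.
  by apply: eq_bigr => i _; rewrite wv.
have sumpE : \sum_i w i *: p i = \sum_i v i *: p i.
  apply/eqP; rewrite -subr_eq0 -sumrB; apply/eqP; rewrite -[RHS]scp.
  by apply: eq_bigr => i _; rewrite wv scalerBl.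
have W0 : 0 < \sum_i w i.
  rewrite lt_def sumr_ge0// andbT; apply: contra_neq ck => /eqP W0.
  have : \sum_i v i == 0 by rewrite -sumE.
  rewrite wv; move: W0; rewrite !psumr_eq0// => /allP/(_ k) wk /allP/(_ k) vk.
  by rewrite (eqP (wk _)) ?(eqP (vk _)) ?subr0// mem_index_enum.
exists ((\sum_i w i)^-1 *: \sum_i w i *: p i) => i.
have [ci|ci] := ltP 0 (c i).
  rewrite sumE sumpE; apply: convex_set_weighted_mean => //; last first.
    by rewrite -sumE.
  move=> j vj; apply: pC; apply: contraTneq vj => <-.
  by rewrite /v -leNgt ge_max lexx andbT oppr_le0 ltW.
apply: convex_set_weighted_mean => // j wj; apply: pC.
apply: contraTneq wj => <-.
by rewrite /w -leNgt ge_max lexx andbT.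
Qed.

(** Helly's theorem for a finite subfamily [s]. Carrying [n] further sets [f]
    through the induction makes each step an instance of [radon_helly], applied to
    the intersection over the tail, the head and the [n] sets of [f]; it also
    lets [f] provide the compact set in [helly_compact]. *)
Lemma helly (R : realType) (n : nat) (I : eqType) (C : I -> set 'rV[R]_n)
    (s : seq I) :
  (forall i, @convex_set R 'rV[R]_n (C i)) ->
  (forall f : 'I_n.+1 -> I, exists x, forall j, C (f j) x) ->
  forall f : 'I_n -> I, exists x, (forall i, i \in s -> C i x) /\
    forall j, C (f j) x.
Proof.
move=> cC CI; elim: s => [|i s IH] f.
  have [I0|/existsNP[i0 _]] := pselect (forall i : I, False).
    by exists 0; split=> // j; case: (I0 (f j)).
  have [x xC] := CI (fun j => oapp f i0 (unlift ord0 j)).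
  by exists x; split=> // j; have := xC (lift ord0 j); rewrite liftK.
pose D (k : 'I_n.+2) : set 'rV[R]_n := match unlift ord0 k with
  | None => [set x | forall i, i \in s -> C i x]
  | Some k' => C (oapp f i (unlift ord0 k'))
  end.
have [|k|x xD] := @radon_helly R n D.
- move=> k; rewrite /D; case: unlift => [k'|]; first exact: cC.
  apply/convex_setP => x y t xC yC t01 j js.
  by move/convex_setP : (cC j); apply => //; [exact: xC|exact: yC].
- case: (unliftP ord0 k) => [k'|] ->; last first.
    (* the family [i :: f], indexed by ['I_n.+1] *)
    have [x xC] := CI (fun j => oapp f i (unlift ord0 j)).
    by exists x => j; rewrite /D; case: (unliftP ord0 j) => [j' _ _|->]; rewrite ?eqxx.
  (* drop the [k']-th set of [i :: f]; unless it is [i], let [i] take its place *)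
  have [x [xs xf]] := IH (fun j => if unlift ord0 k' == Some j then i else f j).
  exists x => j; rewrite /D; case: (unliftP ord0 j) => [j' ->|-> _]; last exact: xs.
  rewrite (inj_eq lift_inj); case: (unliftP ord0 j') => [j'' ->|->] /=.
    move=> jk; have := xf j''; case: eqP => // e.
    by case/eqP: jk; case: (unliftP ord0 k') e => // ? -> [->].
  case: (unliftP ord0 k') xf => [k'' _|->]; last by rewrite eqxx.
  move=> xf _.
  by have := xf k''; rewrite eqxx.
- exists x; split=> [j|j].
    rewrite inE => /orP[/eqP ->|js].
      by have := xD (lift ord0 ord0); rewrite /D liftK unlift_none.
    by have := xD ord0; rewrite /D unlift_none; apply.
  by have := xD (lift ord0 (lift ord0 j)); rewrite /D !liftK.
Qed.

Lemma helly_compact (R : realType) (n : nat) (I : choiceType)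
    (C : I -> set 'rV[R]_n) (f : 'I_n -> I) :
  (forall i, @convex_set R 'rV[R]_n (C i)) -> (forall i, closed (C i)) ->
  compact [set x | forall j, C (f j) x] ->
  (forall g : 'I_n.+1 -> I, exists x, forall j, C (g j) x) ->
  exists x, forall i, C i x.
Proof.
move=> cC clC + CI; set A := [set x | _]; rewrite compact_In0.
move=> /(_ _ setT (fun i => A `&` C i)) [||x xP].
- by exists C => // i _; exact: clC.
- move=> D _; have [x [xD xf]] := helly (finmap.enum_fset D) cC CI f.
  by exists x => i iD; split=> //; exact: xD.
- by exists x => i; have [] := xP i.
Qed.

(** * Quadratic forms between two functions *)

Definition quad (R : realType) (q : 'rV[R]_3) (x y : R) : R :=
  q 0 0 * x ^+ 2 + q 0 1 * (x * y) + q 0 2 * y ^+ 2.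

Lemma quad_continuous (R : realType) (x y : R) :
  continuous (fun q : 'rV[R]_3 => quad q x y).
Proof.
have c i (k : R) : continuous (fun q : 'rV[R]_3 => q 0 i * k).
  move=> q; apply: (@continuousM R _ (fun q : 'rV[R]_3 => q 0 i) (fun=> k)).
    exact: coord_continuous.
  exact: cst_continuous.
move=> q; apply: (@continuousD _ _ _
  (fun q : 'rV[R]_3 => q 0 0 * x ^+ 2 + q 0 1 * (x * y))); last exact: c.
by apply: (@continuousD _ _ _ (fun q : 'rV[R]_3 => q 0 0 * x ^+ 2)); exact: c.
Qed.

Lemma quad_comb (R : realType) (p q : 'rV[R]_3) (s t x y : R) :
  quad (s *: p + t *: q) x y = s * quad p x y + t * quad q x y.
Proof. by rewrite /quad !mxE; ring. Qed.

(** Helly's theorem for the slabs [lo t <= q(t, 1) <= hi t]. Those at the slopes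
    [-1], [0] and [1] bound all three coefficients of [q], which gives the
    compactness that an infinite family needs. *)
Lemma quad_between (R : realType) (lo hi : R -> R) :
  (forall g : 'I_4 -> R, exists q, forall j,
    lo (g j) <= quad q (g j) 1 <= hi (g j)) ->
  exists q, forall t, lo t <= quad q t 1 <= hi t.
Proof.
move=> band4.
pose C t := [set q : 'rV[R]_3 | lo t <= quad q t 1 <= hi t].
have clC t : closed (C t).
  rewrite /C.
  have -> : [set q : 'rV[R]_3 | lo t <= quad q t 1 <= hi t] =
      (fun q => quad q t 1) @^-1` `[lo t, hi t].
    by apply/seteqP; split=> q /=; rewrite in_itv.
  apply: closed_comp; last exact: interval_closed.
  by move=> q _; exact: quad_continuous.
apply: (@helly_compact R 3 R C (fun j => j%:R - 1)) => //.
- move=> t; apply/convex_setP => p q s; rewrite /C /=.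
  move=> /andP[lp ph] /andP[lq qh] /andP[s0 s1].
  rewrite quad_comb; apply/andP; split; nra.
- pose M := `|lo 0| + `|hi 0| + `|lo 1| + `|hi 1| + `|lo (-1)| + `|hi (-1)|.
  have box : compact [set v : 'rV[R]_3 | forall i, `[- M, M]%classic (v ord0 i)].
    apply: (@rV_compact R 3 (fun=> `[- M, M]%classic)) => _.
    exact: segment_compact.
  apply: (subclosed_compact _ box).
    rewrite (_ : [set _ | _] = \bigcap_(j in setT) C ((j : 'I_3)%:R - 1)).
      by apply: closed_bigI => j _; exact: clC.
    by apply/seteqP; split=> q qC j; [move=> _|]; exact: qC.
  move=> q qC i; rewrite /= in_itv /=.
  have := qC 0; have := qC 1; have := qC 2; rewrite /C /quad /=.
  rewrite (_ : 2%:R - 1 = 1 :> R); last by ring.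
  rewrite (_ : 1%:R - 1 = 0 :> R); last by ring.
  rewrite (_ : 0%:R - 1 = -1 :> R); last by ring.
  move=> /andP[a1 b1] /andP[a2 b2] /andP[a3 b3].
  have := ler_norm (hi 0); have := ler_norm (hi 1); have := ler_norm (hi (-1)).
  have := ler_norm (- lo 0); have := ler_norm (- lo 1).
  have := ler_norm (- lo (-1)); have := ler_norm (lo 0); have := ler_norm (lo 1).
  have := ler_norm (lo (-1)); have := ler_norm (- hi 0).
  have := ler_norm (- hi 1); have := ler_norm (- hi (-1)).
  rewrite !normrN /M => ? ? ? ? ? ? ? ? ? ? ? ?.
  have [->|[->|->]] : i = 0 \/ i = 1 \/ i = 2.
    by case: i => -[|[|[|//]]] ?; [left|right; left|right; right]; apply/val_inj.
  - lra.
  - lra.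
  - lra.
Qed.

(** * Norms on the plane that are almost an l1 norm *)

Lemma divr_ge0_le1 (R : realType) (a b : R) : 0 <= a -> 0 < b -> a <= b ->
  0 <= a / b <= 1.
Proof. by move=> a0 b0 ab; rewrite divr_ge0 ?(ltW b0)//= ler_pdivrMr// mul1r. Qed.

(** Convexity on [[0, m]] gives [f m >= 1 - (1 - f l) * m / l], which is enough as
    long as [m < 7 / 8]; from there on [2 * m - 1] is. The hypothesis on
    [f l ^+ 2] implies [7 * (1 - f l) <= 2 * l]. *)
Lemma edge_bound_right (R : realType) (f : R -> R) (l m : R) :
  (forall a b s, 0 <= s <= 1 -> f (s * a + (1 - s) * b) <= s * f a + (1 - s) * f b) ->
  f 0 = 1 -> f 1 = 1 -> (forall m, 0 <= m <= 1 -> 2 * m - 1 <= f m) ->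
  0 <= l <= 1 -> 0 <= f l -> 7 / 9 + (1 - 2 * l) ^+ 2 <= f l ^+ 2 ->
  l <= m <= 1 -> 3 / 4 <= f m.
Proof.
move=> fc f0 f1 fm /andP[l0 l1] fl0 flE /andP[lm m1].
have fl1 : f l <= 1.
  have := fc 1 0 l; rewrite l0 l1 f0 f1 => /(_ isT).
  by rewrite mulr1 mulr0 addr0; lra.
have lgt0 : 0 < l by nra.
have m0 : 0 < m by lra.
have fl7 : 7 * (1 - f l) <= 2 * l.
  rewrite leNgt; apply/negP => fl7.
  have : (7 * f l) ^+ 2 <= (7 - 2 * l) ^+ 2 by rewrite ler_sqr ?nnegrE; lra.
  (* the two bounds on [f l ^+ 2] leave a quadratic in [l] that is positive even
     at its vertex [7 / 16] *)
  have := sqr_ge0 (l - 7 / 16); nra.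
have fmE : f l <= l / m * f m + (1 - l / m).
  have := fc m 0 (l / m); rewrite divfK ?gt_eqF// mulr0 addr0 f0 mulr1; apply.
  exact: divr_ge0_le1.
have {}fmE : m * f l <= l * f m + (m - l).
  have := ler_wpM2l (ltW m0) fmE.
  rewrite (_ : m * (l / m * f m + (1 - l / m)) = l * f m + (m - l))//.
  by field; rewrite gt_eqF.
have [m78|m78] := lerP (7 / 8) m.
  by have := fm m; rewrite (ltW m0) m1 => /(_ isT); lra.
have : 0 <= (7 / 8 - m) * (1 - f l) by apply: mulr_ge0; lra.
move=> h; have : l * (3 / 4) <= l * f m by lra.
by rewrite ler_pM2l.
Qed.

(** The constant [7 / 9] is [16 / 9 - 1]. In the application [f] is a norm along
    an edge of the l1 ball, and [(1 - 2 * l) ^+ 2] measures how far the point where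
    [f] is known is from the midpoint of the edge. *)
Lemma edge_bound (R : realType) (f : R -> R) (l m : R) :
  (forall a b s, 0 <= s <= 1 -> f (s * a + (1 - s) * b) <= s * f a + (1 - s) * f b) ->
  f 0 = 1 -> f 1 = 1 -> (forall m, 0 <= m <= 1 -> `|1 - 2 * m| <= f m) ->
  0 <= l <= 1 -> 7 / 9 + (1 - 2 * l) ^+ 2 <= f l ^+ 2 ->
  0 <= m <= 1 -> 3 / 4 <= f m.
Proof.
move=> fc f0 f1 fm l01 flE /andP[m0 m1].
have fl0 : 0 <= f l by apply: le_trans (fm _ l01).
have [lm|ml] := lerP l m.
  apply: (@edge_bound_right _ _ l) => //; last by rewrite lm.
  by move=> k /fm; rewrite ler_norml; lra.
have -> : f m = f (1 - (1 - m)) by rewrite subKr.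
apply: (@edge_bound_right _ (fun x => f (1 - x)) (1 - l)).
- move=> a b s s01; have := fc (1 - a) (1 - b) s s01.
  by rewrite (_ : s * _ + _ = 1 - (s * a + (1 - s) * b))//; ring.
- by rewrite subr0.
- by rewrite subrr.
- move=> k k01; have := fm (1 - k); rewrite ler_norml => h.
  have : 0 <= 1 - k <= 1 by lra.
  by move=> /h; lra.
- lra.
- by rewrite subKr.
- by rewrite subKr (_ : 1 - 2 * (1 - l) = - (1 - 2 * l)) ?sqrrN//; ring.
- lra.
Qed.

Definition plane_seminorm (R : realType) (N : R -> R -> R) :=
  (forall k x y, N (k * x) (k * y) = `|k| * N x y) /\
  (forall x y x' y', N (x + x') (y + y') <= N x y + N x' y').

(** [N] read in the coordinates of the pair of vectors [(x1, y1)], [(x2, y2)]. *)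
Definition comb (R : realType) (N : R -> R -> R) (x1 y1 x2 y2 s t : R) : R :=
  N (s * x1 + t * x2) (s * y1 + t * y2).

Lemma comb_seminorm (R : realType) (N : R -> R -> R) (x1 y1 x2 y2 : R) :
  plane_seminorm N -> plane_seminorm (comb N x1 y1 x2 y2).
Proof.
move=> [NZ ND]; split=> [k s t|s t s' t'].
  by rewrite /comb -NZ; congr N; ring.
apply: le_trans (ND _ _ _ _).
by rewrite le_eqVlt; apply/orP; left; apply/eqP; congr N; ring.
Qed.

Section PlaneSeminorm.
Variables (R : realType) (N : R -> R -> R).
Hypothesis normN : plane_seminorm N.

Let NZ k x y : N (k * x) (k * y) = `|k| * N x y. Proof. by case: normN. Qed.
Let ND x y x' y' : N (x + x') (y + y') <= N x y + N x' y'.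
Proof. by case: normN. Qed.

Lemma plane_seminormN x y : N (- x) (- y) = N x y.
Proof. by rewrite -[- x]mulN1r -[- y]mulN1r NZ normrN1 mul1r. Qed.

Lemma plane_seminorm_ge0 x y : 0 <= N x y.
Proof.
have := ND x y (- x) (- y); rewrite !subrr plane_seminormN.
by have := NZ 0 0 0; rewrite !mul0r normr0 mul0r; lra.
Qed.

Lemma plane_seminorm_le x y : N x y <= `|x| * N 1 0 + `|y| * N 0 1.
Proof.
apply: le_trans (_ : N (x * 1 + y * 0) (x * 0 + y * 1) <= _).
  by rewrite !mulr1 !mulr0 addr0 add0r.
by apply: le_trans (ND _ _ _ _) _; rewrite !NZ.
Qed.

(** Let [f] be the restriction of [N] to the edge from [(0, 1)] to [(1, 0)]. The
    triangle inequality at [(A', - B')] leaves, for the term at [(A, B)],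
    [7 / 9 * (A + B) ^+ 2 + (B - A) ^+ 2 <= N A B ^+ 2]; the balance condition
    [w * A * B = w' * A' * B'] turns the cross term at [(A', - B')] into the one at
    [(A, B)]. After division
    by [(A + B) ^+ 2] this is the hypothesis of [edge_bound]. *)
Lemma quadrant_bound (A B A' B' w w' : R) : N 1 0 = 1 -> N 0 1 = 1 ->
  0 < A -> 0 < B -> 0 <= A' -> 0 <= B' -> 0 < w -> 0 < w' ->
  w * A * B = w' * A' * B' ->
  16 / 9 * (w * (A ^+ 2 + B ^+ 2) + w' * (A' ^+ 2 + B' ^+ 2)) <=
    w * N A B ^+ 2 + w' * N A' (- B') ^+ 2 ->
  forall x y, 0 <= x -> 0 <= y -> 3 / 4 * (x + y) <= N x y.
Proof.
move=> N10 N01 A0 B0 A'0 B'0 w0 w'0 wAB Nge x y x0 y0.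
have N'le : N A' (- B') <= A' + B'.
  by have := plane_seminorm_le A' (- B'); rewrite N10 N01 !mulr1 normrN !ger0_norm.
have N'sq : N A' (- B') ^+ 2 <= (A' + B') ^+ 2.
  by rewrite ler_sqr ?nnegrE ?plane_seminorm_ge0 ?addr_ge0.
have Nsq : 7 / 9 * (A + B) ^+ 2 + (B - A) ^+ 2 <= N A B ^+ 2.
  have h1 : w' * N A' (- B') ^+ 2 <= w' * (A' + B') ^+ 2 by rewrite ler_pM2l.
  have h2 : 0 <= w' * (A' - B') ^+ 2 by rewrite mulr_ge0 ?sqr_ge0 ?ltW.
  suff : w * (7 / 9 * (A + B) ^+ 2 + (B - A) ^+ 2) <= w * N A B ^+ 2.
    by rewrite ler_pM2l.
  by nra.
have [/eqP|xy0] := eqVneq (x + y) 0.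
  rewrite paddr_eq0// => /andP[/eqP -> /eqP ->].
  by rewrite addr0 mulr0 plane_seminorm_ge0.
have {xy0} xy : 0 < x + y by rewrite lt_def xy0 addr_ge0.
have AB : 0 < A + B by rewrite addr_gt0.
pose f s := N s (1 - s).
have NE a b : 0 < a + b -> N a b = (a + b) * f (a / (a + b)).
  move=> ab; rewrite /f -{1}(gtr0_norm ab) -NZ; congr N.
    by rewrite mulrC divfK ?gt_eqF.
  by field; rewrite gt_eqF.
rewrite NE// mulrC ler_pM2l//; apply: (@edge_bound _ f (A / (A + B))).
- move=> a b s /andP[s0 s1]; rewrite /f.
  have := ND (s * a) (s * (1 - a)) ((1 - s) * b) ((1 - s) * (1 - b)).
  rewrite !NZ !ger0_norm ?subr_ge0//; apply: le_trans.
  by rewrite le_eqVlt; apply/orP; left; apply/eqP; congr N; ring.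
- by rewrite /f subr0.
- by rewrite /f subrr.
- move=> m /andP[m0 m1]; rewrite /f.
  have := ND m (1 - m) (- m * 1) (- m * 0).
  have := ND m (1 - m) (- (1 - m) * 0) (- (1 - m) * 1).
  rewrite [X in N X _](_ : _ = m * 1); last by ring.
  rewrite [X in N _ X](_ : _ = m * 0); last by ring.
  rewrite [X in _ -> N X _ <= _ -> _](_ : _ = (1 - m) * 0); last by ring.
  rewrite [X in _ -> N _ X <= _ -> _](_ : _ = (1 - m) * 1); last by ring.
  by rewrite !NZ N10 N01 !normrN (ger0_norm m0) ger0_norm ?subr_ge0// ler_norml; lra.
- by apply: divr_ge0_le1; rewrite ?lerDl// ltW.
- move: Nsq; rewrite NE// exprMn => Nsq.
  rewrite -(ler_pM2l (_ : 0 < (A + B) ^+ 2)) ?exprn_gt0//.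
  apply: le_trans Nsq; rewrite le_eqVlt; apply/orP; left; apply/eqP.
  by field; rewrite gt_eqF.
- by apply: divr_ge0_le1; rewrite ?lerDl.
Qed.

End PlaneSeminorm.

(** The hypotheses are symmetric under reflection in the first axis followed by
    the exchange of the two test vectors, so [quadrant_bound] covers the adjacent
    quadrant as well. *)
Lemma octant_bounds (R : realType) (M : R -> R -> R) (A B A' B' w w' : R) :
  plane_seminorm M -> M 1 0 = 1 -> M 0 1 = 1 ->
  0 < A -> 0 < B -> 0 < A' -> 0 < B' -> 0 < w -> 0 < w' ->
  w * A * B = w' * A' * B' ->
  16 / 9 * (w * (A ^+ 2 + B ^+ 2) + w' * (A' ^+ 2 + B' ^+ 2)) <=
    w * M A B ^+ 2 + w' * M A' (- B') ^+ 2 ->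
  forall x y, 3 / 4 * (`|x| + `|y|) <= M x y.
Proof.
move=> sM M10 M01 A0 B0 A'0 B'0 w0 w'0 wE Mge x y.
have pos : forall x y, 0 <= x -> 0 <= y -> 3 / 4 * (x + y) <= M x y.
  by apply: (quadrant_bound sM M10 M01 A0 B0 (ltW A'0) (ltW B'0) w0 w'0 wE Mge).
have neg u v : 0 <= u -> 0 <= v -> 3 / 4 * (u + v) <= M u (- v).
  have CE s t : comb M 1 0 0 (-1) s t = M s (- t).
    by rewrite /comb; congr M; ring.
  rewrite -CE; apply: (quadrant_bound (comb_seminorm 1 0 0 (-1) sM) _ _ A'0 B'0
    (ltW A0) (ltW B0) w'0 w0 (esym wE)).
  - by rewrite CE oppr0.
  - by rewrite CE -(plane_seminormN sM) oppr0 opprK.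
  - by rewrite !CE opprK; lra.
have [x0|x0] := ger0P x; have [y0|y0] := ger0P y.
- exact: pos.
- by rewrite -[X in _ <= M _ X]opprK; apply: neg; rewrite ?oppr_ge0// ltW.
- by rewrite -(plane_seminormN sM); apply: neg; rewrite ?oppr_ge0// ltW.
- by rewrite -(plane_seminormN sM); apply: pos; rewrite ?oppr_ge0// ltW.
Qed.

(** When [N] is the gauge of a body [K], this says that the parallelogram with vertices
    [(x1, y1)], [(x2, y2)] and their opposites lies in [K], and [K] in its dilate by
    [4 / 3]. *)
Definition near_square (R : realType) (N : R -> R -> R) :=
  exists x1 y1 x2 y2, forall s t,
    3 / 4 * (`|s| + `|t|) <= comb N x1 y1 x2 y2 s t <= `|s| + `|t|.

(** The test vectors are [u = p v1 + q v2] and [u' = p' v1 - q' v2]; the balance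
    condition says that [w * u u^T + w' * u' u'^T] is diagonal in the basis
    [v1, v2]. Rescaling [v1] and [v2] to norm 1 reduces to [octant_bounds]. *)
Lemma near_square_of_alternation (R : realType) (N : R -> R -> R)
    (x1 y1 x2 y2 p q p' q' w w' : R) : plane_seminorm N ->
  0 < N x1 y1 -> 0 < N x2 y2 ->
  0 < p -> 0 < q -> 0 < p' -> 0 < q' -> 0 < w -> 0 < w' ->
  w * p * q = w' * p' * q' ->
  16 / 9 * ((w * p ^+ 2 + w' * p' ^+ 2) * N x1 y1 ^+ 2 +
            (w * q ^+ 2 + w' * q' ^+ 2) * N x2 y2 ^+ 2) <=
    w * comb N x1 y1 x2 y2 p q ^+ 2 + w' * comb N x1 y1 x2 y2 p' (- q') ^+ 2 ->
  near_square N.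
Proof.
move=> sN; set a := N x1 y1; set b := N x2 y2 => a0 b0 p0 q0 p'0 q'0 w0 w'0 wE Nge.
exists (x1 / a), (y1 / a), (x2 / b), (y2 / b).
set M := comb N _ _ _ _.
have sM : plane_seminorm M by exact: comb_seminorm.
have ME s t : M (s * a) (t * b) = comb N x1 y1 x2 y2 s t.
  by rewrite /M /comb; congr N; field; rewrite !gt_eqF.
have MZ k s t : M (k * s) (k * t) = `|k| * M s t by case: sM => ->.
have M10 : M 1 0 = 1.
  apply: (mulfI (lt0r_neq0 a0)); rewrite -{1}(gtr0_norm a0) -MZ mulr0 !mulr1.
  by rewrite -(mul0r b) -{1}(mul1r a) ME /comb !mul1r !mul0r !addr0.
have M01 : M 0 1 = 1.
  apply: (mulfI (lt0r_neq0 b0)); rewrite -{1}(gtr0_norm b0) -MZ mulr0 !mulr1.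
  by rewrite -(mul0r a) -{1}(mul1r b) ME /comb !mul1r !mul0r !add0r.
move=> s t; apply/andP; split; last first.
  by have := plane_seminorm_le sM s t; rewrite M10 M01 !mulr1.
apply: (@octant_bounds _ M (p * a) (q * b) (p' * a) (q' * b) w w') => //.
- exact: mulr_gt0.
- exact: mulr_gt0.
- exact: mulr_gt0.
- exact: mulr_gt0.
- rewrite (_ : w * _ * _ = w * p * q * (a * b)); last by ring.
  by rewrite wE; ring.
- rewrite -mulNr !ME; apply: le_trans Nge; rewrite le_eqVlt; apply/orP; left.
  by apply/eqP; ring.
Qed.

(** * Quadratic interpolation at four points *)

Lemma quad_newton (R : realType) (t1 t2 c0 c1 c2 : R) : exists q, forall t,
  quad q t 1 = c0 + c1 * (t - t1) + c2 * ((t - t1) * (t - t2)).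
Proof.
exists (\row_(i < 3) [:: c2; c1 - c2 * (t1 + t2); c0 - c1 * t1 + c2 * t1 * t2]`_i).
by move=> t; rewrite /quad !mxE /=; ring.
Qed.

(** Newton's formula; the slopes may coincide, since the divided differences with
    denominator 0 then vanish and the repeated conditions agree. *)
Lemma quad_interp3 (R : realType) (G : R -> R) (t1 t2 t3 : R) : exists q,
  [/\ quad q t1 1 = G t1, quad q t2 1 = G t2 & quad q t3 1 = G t3].
Proof.
pose c1 := (G t2 - G t1) / (t2 - t1).
have [q qE] := quad_newton t1 t2 (G t1) c1
  ((G t3 - (G t1 + c1 * (t3 - t1))) / ((t3 - t1) * (t3 - t2))).
have q1 : quad q t1 1 = G t1 by rewrite qE !subrr; ring.
have q2 : quad q t2 1 = G t2.
  have [<-//|t12] := eqVneq t1 t2.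
  have n21 : t2 - t1 != 0 by rewrite subr_eq0 eq_sym.
  by rewrite qE subrr !mulr0 addr0 /c1 divfK // addrC subrK.
exists q; split=> //.
have [->//|t31] := eqVneq t3 t1; have [->//|t32] := eqVneq t3 t2.
have n31 : t3 - t1 != 0 by rewrite subr_eq0.
have n32 : t3 - t2 != 0 by rewrite subr_eq0.
by rewrite qE; field; rewrite n31 n32.
Qed.

Lemma subr_neq0_gt (R : realType) (a b : R) : a < b -> b - a != 0.
Proof. by move=> ab; rewrite subr_eq0 gt_eqF. Qed.

Section Lagrange.
Variables (R : realType) (t1 t2 t3 t4 : R).

(** Up to sign, the Lagrange coefficients that extrapolate from [t1 < t2 < t3] to
    [t4]; see [quad_extrapolation]. *)
Definition lagrange1 := (t4 - t2) * (t4 - t3) / ((t2 - t1) * (t3 - t1)).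
Definition lagrange2 := (t4 - t1) * (t4 - t3) / ((t2 - t1) * (t3 - t2)).
Definition lagrange3 := (t4 - t1) * (t4 - t2) / ((t3 - t1) * (t3 - t2)).

Lemma lagrange_gt0 : t1 < t2 -> t2 < t3 -> t3 < t4 ->
  [/\ 0 < lagrange1, 0 < lagrange2 & 0 < lagrange3].
Proof.
by move=> t12 t23 t34; split; apply: divr_gt0; apply: mulr_gt0; lra.
Qed.

Lemma quad_extrapolation (z1 z2 z3 : R) : t1 < t2 -> t2 < t3 -> t3 < t4 ->
  exists q,
  [/\ quad q t1 1 = z1, quad q t2 1 = z2, quad q t3 1 = z3 &
      quad q t4 1 = lagrange1 * z1 - lagrange2 * z2 + lagrange3 * z3].
Proof.
move=> t12 t23 t34; pose c1 := (z2 - z1) / (t2 - t1).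
have [q qE] := quad_newton t1 t2 z1 c1
  ((z3 - (z1 + c1 * (t3 - t1))) / ((t3 - t1) * (t3 - t2))).
have n21 : t2 - t1 != 0 by apply: subr_neq0_gt; lra.
have n31 : t3 - t1 != 0 by apply: subr_neq0_gt; lra.
have n32 : t3 - t2 != 0 by apply: subr_neq0_gt; lra.
exists q; rewrite !qE /c1 /lagrange1 /lagrange2 /lagrange3.
by split; field; rewrite ?n21 ?n31 ?n32.
Qed.

(** As the value at [t4] is increasing in those at [t1], [t3] and decreasing in the
    one at [t2], its range over all admissible choices at [t1], [t2], [t3] is the
    segment between the values of two extreme interpolants [p] and [q]. Either this
    segment meets [[G t4, k * G t4]], and a convex combination of [p] and [q] fits,
    or it lies on one side, which is one of the two inequalities. *)
Lemma quad_fit4 (G : R -> R) (k : R) : t1 < t2 -> t2 < t3 -> t3 < t4 ->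
  1 <= k -> (forall t, 0 <= G t) ->
  [\/ exists q, forall t, t \in [:: t1; t2; t3; t4] ->
        G t <= quad q t 1 <= k * G t,
      k * (lagrange2 * G t2 + G t4) <= lagrange1 * G t1 + lagrange3 * G t3
    | k * (lagrange1 * G t1 + lagrange3 * G t3) <= lagrange2 * G t2 + G t4].
Proof.
move=> t12 t23 t34 k1 G0.
have [L1 L2 L3] := lagrange_gt0 t12 t23 t34.
have [p [p1 p2 p3 p4]] := quad_extrapolation (G t1) (k * G t2) (G t3) t12 t23 t34.
have [q [q1 q2 q3 q4]] := quad_extrapolation (k * G t1) (G t2) (k * G t3) t12 t23 t34.
have Gk t : G t <= k * G t by rewrite ler_peMl.
have fit (r : 'rV[R]_3) s : 0 <= s <= 1 -> r = s *: p + (1 - s) *: q ->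
    G t4 <= quad r t4 1 <= k * G t4 ->
    forall t, t \in [:: t1; t2; t3; t4] -> G t <= quad r t 1 <= k * G t.
  move=> /andP[s0 s1] -> r4 t; rewrite !inE => /or4P[]/eqP -> //;
    rewrite quad_comb ?(p1, p2, p3, q1, q2, q3).
  - by have := Gk t1; nra.
  - by have := Gk t2; nra.
  - by have := Gk t3; nra.
have [pk|pk] := lerP (quad p t4 1) (k * G t4); last first.
  by apply: Or32; lra.
have [Gq|Gq] := lerP (G t4) (quad q t4 1); last first.
  by apply: Or33; lra.
apply: Or31.
have [Gp|pG] := lerP (G t4) (quad p t4 1).
  by exists p; apply: (fit _ 1);
    rewrite ?subrr ?scale0r ?scale1r ?addr0 ?Gp// lexx ler01.
have [qk|kq] := lerP (quad q t4 1) (k * G t4).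
  by exists q; apply: (fit _ 0);
    rewrite ?subr0 ?scale0r ?scale1r ?add0r ?Gq// lexx ler01.
pose s := (quad q t4 1 - G t4) / (quad q t4 1 - quad p t4 1).
exists (s *: p + (1 - s) *: q); apply: (fit _ s) => //.
  by apply: divr_ge0_le1; have := Gk t4; lra.
rewrite quad_comb (_ : _ + _ = G t4) ?lexx ?Gk// /s.
by field; have := Gk t4; lra.
Qed.

End Lagrange.

(** When no form fits, one of the pairs [t1, t3] and [t2, t4] plays the part of
    the test vectors and the other pair that of the basis; as the two pairs interlace,
    one test vector is in the first quadrant of the basis and the other in an
    adjacent one. *)
Lemma alternative4 (R : realType) (N : R -> R -> R) (t1 t2 t3 t4 : R) :
  plane_seminorm N -> (forall t, 0 < N t 1) ->
  t1 < t2 -> t2 < t3 -> t3 < t4 ->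
  near_square N \/ exists q, forall t, t \in [:: t1; t2; t3; t4] ->
    N t 1 ^+ 2 <= quad q t 1 <= 16 / 9 * N t 1 ^+ 2.
Proof.
move=> sN N0 t12 t23 t34.
have n21 : t2 - t1 != 0 by apply: subr_neq0_gt; lra.
have n31 : t3 - t1 != 0 by apply: subr_neq0_gt; lra.
have n32 : t3 - t2 != 0 by apply: subr_neq0_gt; lra.
have n42 : t4 - t2 != 0 by apply: subr_neq0_gt; lra.
have [L1 L2 L3] := lagrange_gt0 t12 t23 t34.
have [||qE|bad|bad] := quad_fit4 (G := fun t => N t 1 ^+ 2) (k := 16 / 9) t12 t23 t34.
- by lra.
- by move=> t; exact: sqr_ge0.
- by right.
- left; apply: (@near_square_of_alternation _ N t2 1 t4 1
    ((t4 - t3) / (t4 - t2)) ((t3 - t2) / (t4 - t2))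
    ((t4 - t1) / (t4 - t2)) ((t2 - t1) / (t4 - t2))
    (lagrange3 t1 t2 t3 t4) (lagrange1 t1 t2 t3 t4)) => //.
  + by apply: divr_gt0; lra.
  + by apply: divr_gt0; lra.
  + by apply: divr_gt0; lra.
  + by apply: divr_gt0; lra.
  + by rewrite /lagrange1 /lagrange3; field; rewrite ?n21 ?n31 ?n32 ?n42.
  + have -> : comb N t2 1 t4 1 ((t4 - t3) / (t4 - t2)) ((t3 - t2) / (t4 - t2)) = N t3 1.
      by rewrite /comb; congr N; field.
    have -> : comb N t2 1 t4 1 ((t4 - t1) / (t4 - t2))
        (- ((t2 - t1) / (t4 - t2))) = N t1 1.
      by rewrite /comb; congr N; field.
    rewrite [leRHS]addrC; apply: le_trans bad.
    rewrite le_eqVlt; apply/orP; left; apply/eqP.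
    by rewrite /lagrange1 /lagrange2 /lagrange3; field; rewrite ?n21 ?n31 ?n32 ?n42.
- left; apply: (@near_square_of_alternation _ N t1 1 t3 1
    ((t3 - t2) / (t3 - t1)) ((t2 - t1) / (t3 - t1))
    ((t4 - t3) / (t3 - t1)) ((t4 - t1) / (t3 - t1))
    (lagrange2 t1 t2 t3 t4) 1) => //.
  + by apply: divr_gt0; lra.
  + by apply: divr_gt0; lra.
  + by apply: divr_gt0; lra.
  + by apply: divr_gt0; lra.
  + by rewrite /lagrange2; field; rewrite ?n21 ?n31 ?n32 ?n42.
  + have -> : comb N t1 1 t3 1 ((t3 - t2) / (t3 - t1)) ((t2 - t1) / (t3 - t1)) = N t2 1.
      by rewrite /comb; congr N; field.
    have -> : comb N t1 1 t3 1 ((t4 - t3) / (t3 - t1))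
        (- ((t4 - t1) / (t3 - t1))) = N t4 1.
      by rewrite -[RHS](plane_seminormN sN) /comb; congr N; field.
    rewrite [1 * N _ _ ^+ 2]mul1r; apply: le_trans bad.
    rewrite le_eqVlt; apply/orP; left; apply/eqP.
    by rewrite /lagrange1 /lagrange2 /lagrange3; field; rewrite ?n21 ?n31 ?n32 ?n42.
Qed.

(** * The alternative for all slopes *)

Lemma le0_of_le_linear (R : realFieldType) (a K : R) :
  (forall y, 0 < y <= 1 -> a <= K * y) -> a <= 0.
Proof.
move=> aK; rewrite leNgt; apply/negP => a0.
have K1 : a <= K by rewrite -[K]mulr1; apply: aK; rewrite ltr01 lexx.
have K0 : 0 < K by apply: lt_le_trans K1.
have : a <= K * (a / (2 * K)).
  apply: aK; rewrite divr_gt0 ?mulr_gt0//= ler_pdivrMr ?mulr_gt0//; lra.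
rewrite (_ : K * _ = a / 2); last by field; rewrite gt_eqF.
lra.
Qed.

(** The horizontal direction is not of the form [(t, 1)]; it is reached as a limit,
    with an error linear in [y] on both sides. *)
Lemma quad_bounds_at_infinity (R : realType) (N : R -> R -> R) q (k : R) :
  plane_seminorm N -> 0 <= k ->
  (forall y, 0 < y <= 1 -> N 1 y ^+ 2 <= quad q 1 y <= k * N 1 y ^+ 2) ->
  N 1 0 ^+ 2 <= quad q 1 0 <= k * N 1 0 ^+ 2.
Proof.
move=> sN k0 qN; set n := N 1 0; set m := N 0 1.
have n0 : 0 <= n by exact: plane_seminorm_ge0.
have m0 : 0 <= m by exact: plane_seminorm_ge0.
have bnd y : 0 < y <= 1 -> [/\ 0 <= N 1 y, n <= N 1 y + y * m & N 1 y <= n + y * m].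
  move=> /andP[y0 _]; split; first exact: plane_seminorm_ge0.
  - have := (sN.2 1 y (- y * 0) (- y * 1)).
    by rewrite sN.1 normrN gtr0_norm// mulr0 mulr1 addr0 subrr.
  - have := (sN.2 1 0 (y * 0) (y * 1)).
    by rewrite sN.1 gtr0_norm// mulr0 mulr1 addr0 add0r.
have quadE y : quad q 1 y = q 0 0 + q 0 1 * y + q 0 2 * y ^+ 2.
  by rewrite /quad; ring.
have coef (c y e : R) : 0 < y <= 1 -> (e = y \/ e = y ^+ 2) ->
    - (`|c| * y) <= c * e <= `|c| * y.
  move=> /andP[y0 y1] ee; rewrite -ler_norml normrM ler_wpM2l//.
  by case: ee => ->; rewrite ger0_norm ?sqr_ge0 ?(ltW y0)// expr2 ler_piMl// ltW.
rewrite quadE mulr0 expr0n mulr0 !addr0; apply/andP; split; rewrite -subr_le0.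
- apply: (@le0_of_le_linear _ _ (2 * m * (n + m) + m ^+ 2 + `|q 0 1| + `|q 0 2|)).
  move=> y y01; have [N0 h1 h2] := bnd y y01; have /andP[h3 _] := qN y y01.
  have /andP[_ c1] := coef (q 0 1) _ _ y01 (or_introl erefl).
  have /andP[_ c2] := coef (q 0 2) _ _ y01 (or_intror erefl).
  move: h3 y01; rewrite quadE => h3 /andP[y0 y1].
  have : n ^+ 2 <= (N 1 y + y * m) ^+ 2.
    by rewrite ler_sqr ?nnegrE// addr_ge0// mulr_ge0// ltW.
  have : y * m * N 1 y <= y * m * (n + m).
    apply: ler_wpM2l; first by rewrite mulr_ge0// ltW.
    by apply: le_trans h2 _; rewrite lerD2l ler_piMl.
  have : y ^+ 2 * m ^+ 2 <= y * m ^+ 2.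
    by apply: ler_wpM2r; rewrite ?sqr_ge0// expr2 ler_piMl// ltW.
  lra.
- apply: (@le0_of_le_linear _ _ (k * (2 * m * n + m ^+ 2) + `|q 0 1| + `|q 0 2|)).
  move=> y y01; have [N0 h1 h2] := bnd y y01; have /andP[_ h3] := qN y y01.
  have /andP[c1 _] := coef (q 0 1) _ _ y01 (or_introl erefl).
  have /andP[c2 _] := coef (q 0 2) _ _ y01 (or_intror erefl).
  move: h3 y01; rewrite quadE => h3 /andP[y0 y1].
  have : k * N 1 y ^+ 2 <= k * (n + y * m) ^+ 2.
    by rewrite ler_wpM2l// ler_sqr ?nnegrE// addr_ge0// mulr_ge0// ltW.
  have : k * (y ^+ 2 * m ^+ 2) <= k * (y * m ^+ 2).
    apply: ler_wpM2l => //.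
    by apply: ler_wpM2r; rewrite ?sqr_ge0// expr2 ler_piMl// ltW.
  lra.
Qed.

(** Four distinct slopes are the only case with content: fewer can be fitted
    exactly by [quad_interp3]. *)
Lemma near_square_or_ellipse (R : realType) (N : R -> R -> R) :
  plane_seminorm N -> (forall t, 0 < N t 1) ->
  near_square N \/ exists q, forall x y,
    N x y ^+ 2 <= quad q x y <= 16 / 9 * N x y ^+ 2.
Proof.
move=> sN N0; have [sq|nsq] := pselect (near_square N); [by left|right].
have [q qN] : exists q, forall t,
    N t 1 ^+ 2 <= quad q t 1 <= 16 / 9 * N t 1 ^+ 2.
  apply: quad_between => g.
  suff [q qP] : exists q, forall t, t \in codom g ->
      N t 1 ^+ 2 <= quad q t 1 <= 16 / 9 * N t 1 ^+ 2.
    by exists q => j; apply: qP; exact: codom_f.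
  suff : exists q, forall t, t \in sort <=%R (codom g) ->
      N t 1 ^+ 2 <= quad q t 1 <= 16 / 9 * N t 1 ^+ 2.
    by move=> [q qP]; exists q => t; rewrite -(mem_sort <=%R); exact: qP.
  have : sorted <=%R (sort <=%R (codom g)) by apply: sort_sorted; exact: le_total.
  have : size (sort <=%R (codom g)) = 4 by rewrite size_sort size_codom card_ord.
  case: (sort _ _) => [|a [|b [|c [|d [|//]]]]] //= _ /and4P[ab bc cd _].
  have fit3 u v w : exists q, forall t, t \in [:: u; v; w] ->
      N t 1 ^+ 2 <= quad q t 1 <= 16 / 9 * N t 1 ^+ 2.
    have [q [q1 q2 q3]] := quad_interp3 (fun t => N t 1 ^+ 2) u v w.
    exists q => t; rewrite !inE => /or3P[]/eqP ->; rewrite ?(q1, q2, q3) lexx /=;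
      by rewrite ler_peMl ?sqr_ge0//; lra.
  have [eab|nab] := eqVneq a b.
    have [q qP] := fit3 b c d; exists q => t; rewrite eab inE => /orP[/eqP ->|//].
      by apply: qP; rewrite mem_head.
    exact: qP.
  have [ebc|nbc] := eqVneq b c.
    have [q qP] := fit3 a c d; exists q => t; rewrite ebc => tabcd; apply: qP.
    by move: tabcd; rewrite !inE => /or4P[]->; rewrite ?orbT.
  have [ecd|ncd] := eqVneq c d.
    have [q qP] := fit3 a b d; exists q => t; rewrite ecd => tabcd; apply: qP.
    by move: tabcd; rewrite !inE => /or4P[]->; rewrite ?orbT.
  have [|||//|//] := @alternative4 _ N a b c d sN N0;
    by rewrite lt_neqAle ?nab ?nbc ?ncd.
exists q => x y.
have quadZ (k u v : R) : quad q (k * u) (k * v) = k ^+ 2 * quad q u v.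
  by rewrite /quad; ring.
have bndZ (k u v : R) : N u v ^+ 2 <= quad q u v <= 16 / 9 * N u v ^+ 2 ->
    N (k * u) (k * v) ^+ 2 <= quad q (k * u) (k * v) <= 16 / 9 * N (k * u) (k * v) ^+ 2.
  rewrite quadZ sN.1 exprMn real_normK ?num_real// [16 / 9 * _]mulrCA => /andP[h1 h2].
  have k2 := sqr_ge0 k; apply/andP; split; nra.
have [->|y0] := eqVneq y 0; last first.
  have := bndZ y _ _ (qN (x / y)).
  by rewrite mulr1 mulrC divfK.
have := bndZ x 1 0; rewrite mulr1 mulr0; apply.
apply: quad_bounds_at_infinity => // v /andP[v0 _].
have := bndZ v _ _ (qN v^-1).
by rewrite mulr1 divff ?gt_eqF.
Qed.

(** * Bounds for the Banach-Mazur distance *)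

Lemma BM_dist_le (R : realType) (n : nat) (K L : set 'rV[R]_n) (u : 'rV[R]_n)
    (M : 'M[R]_n) (rho : R) :
  0 < rho -> M \in unitmx ->
  translate u K `<=` [set l *m M | l in L] ->
  (forall l, L l -> translate u K (rho^-1 *: (l *m M))) ->
  (BM_dist K L <= rho%:E)%E.
Proof.
move=> rho0 Mu KL LK; apply: ereal_inf_lbound; exists rho => //; split=> //.
have t0 : translate 0 L = L.
  apply/seteqP; split=> [_ [x Lx <-]|x Lx]; first by rewrite addr0.
  by exists x; rewrite ?addr0.
exists (mulmxr M), u, 0; rewrite t0; split.
- by exists (mulmxr (invmx M)) => x /=; rewrite ?mulmxK ?mulmxKV.
- exact: KL.
- move=> _ [l Ll <-]; exists (rho^-1 *: (l *m M)); first exact: LK.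
  by rewrite scalerA divff ?gt_eqF// scale1r.
Qed.

Lemma injective_unitmx (F : fieldType) (n : nat) (M : 'M[F]_n) :
  (forall v : 'rV_n, v *m M = 0 -> v = 0) -> M \in unitmx.
Proof. by move=> /inj_row_free; rewrite row_free_unit. Qed.

Definition vec2 (R : realType) (x y : R) : 'rV[R]_2 :=
  \row_i (if i == 0 then x else y).

Lemma vec2E (R : realType) (v : 'rV[R]_2) : v = vec2 (v 0 0) (v 0 1).
Proof.
apply/rowP => i; rewrite mxE; case: eqP => [->//|i0]; congr (v _ _).
by apply: val_inj; case: i i0 => -[|[|//]] //= p []; apply/val_inj.
Qed.

Lemma vec2_comb (R : realType) (s t x y x' y' : R) :
  s *: vec2 x y + t *: vec2 x' y' = vec2 (s * x + t * x') (s * y + t * y').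
Proof. by apply/rowP => i; rewrite !mxE; case: eqP. Qed.

Definition mx2 (R : realType) (r s : 'rV[R]_2) : 'M[R]_2 :=
  \matrix_i (if i == 0 then r else s).

Lemma mulmx2 (R : realType) (v r s : 'rV[R]_2) :
  v *m mx2 r s = v 0 0 *: r + v 0 1 *: s.
Proof.
rewrite mulmx_sum_row !big_ord_recl big_ord0 addr0 !rowK /=.
by congr (_ *: _ + v _ _ *: _); apply/val_inj.
Qed.

Section Bounds.
Variables (R : realType) (K : set 'rV[R]_2) (u : 'rV[R]_2) (N : R -> R -> R).
Hypothesis sN : plane_seminorm N.
Hypothesis NK : translate u K = [set x | N (x 0 0) (x 0 1) <= 1].

Lemma unit_scaled (x : 'rV[R]_2) : N (x 0 0) (x 0 1) <= 4 / 3 ->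
  translate u K ((4 / 3)^-1 *: x).
Proof.
rewrite NK /= !mxE sN.1 ger0_norm; last lra.
by lra.
Qed.

(** The images under [M] of the corners of the square are the vertices of the
    parallelogram of [near_square], dilated by [4 / 3]. *)
Lemma BM_dist_cube_le : near_square N -> (BM_dist K (cube R 2) <= (4 / 3)%:E)%E.
Proof.
move=> [x1 [y1 [x2 [y2 sq]]]].
pose M := mx2 (vec2 (2 / 3 * (x1 + x2)) (2 / 3 * (y1 + y2)))
              (vec2 (2 / 3 * (x1 - x2)) (2 / 3 * (y1 - y2))).
have ME (l : 'rV[R]_2) : N ((l *m M) 0 0) ((l *m M) 0 1) =
    comb N x1 y1 x2 y2 (2 / 3 * (l 0 0 + l 0 1)) (2 / 3 * (l 0 0 - l 0 1)).
  by rewrite /M mulmx2 vec2_comb !mxE /=; congr N; ring.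
have n23 (t : R) : `|2 / 3 * t| = 2 / 3 * `|t|.
  by rewrite normrM ger0_norm.
have Mu : M \in unitmx.
  apply: injective_unitmx => v vM0.
  have := ME v; rewrite vM0 !mxE => N0.
  have := sq (2 / 3 * (v 0 0 + v 0 1)) (2 / 3 * (v 0 0 - v 0 1)).
  have N00 : N 0 0 = 0 by have := sN.1 0 0 0; rewrite !mul0r normr0 mul0r.
  rewrite -N0 N00 !n23 => /andP[h _].
  have := normr_ge0 (v 0 0 + v 0 1); have := normr_ge0 (v 0 0 - v 0 1).
  move=> h1 h2.
  have /eqP : `|v 0 0 + v 0 1| = 0 by lra.
  have /eqP : `|v 0 0 - v 0 1| = 0 by lra.
  rewrite !normr_eq0 => /eqP e1 /eqP e2.
  rewrite [v]vec2E [RHS]vec2E !mxE; congr vec2; lra.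
apply: (@BM_dist_le _ _ _ _ u M) => //.
- rewrite NK => x /= Nx; exists (x *m invmx M); last by rewrite mulmxKV.
  set l := x *m invmx M; have lM : l *m M = x by rewrite mulmxKV.
  have := sq (2 / 3 * (l 0 0 + l 0 1)) (2 / 3 * (l 0 0 - l 0 1)).
  rewrite -ME lM !n23 => /andP[h _].
  have {h} h : `|l 0 0 + l 0 1| + `|l 0 0 - l 0 1| <= 2 by lra.
  have := ler_norm (l 0 0 + l 0 1); have := ler_norm (- (l 0 0 + l 0 1)).
  have := ler_norm (l 0 0 - l 0 1); have := ler_norm (- (l 0 0 - l 0 1)).
  rewrite !normrN => h1 h2 h3 h4 i.
  have [->|->] : i = 0 \/ i = 1.
    by case: i => -[|[|//]] ?; [left|right]; apply/val_inj.
  - by lra.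
  - by lra.
- move=> l lP; apply: unit_scaled; rewrite ME.
  have /andP[_ h] := sq (2 / 3 * (l 0 0 + l 0 1)) (2 / 3 * (l 0 0 - l 0 1)).
  apply: le_trans h _; rewrite !n23.
  have := lP 0; have := lP 1; move=> /andP[a1 b1] /andP[a0 b0].
  have [|] := ger0P (l 0 0 + l 0 1); have [|] := ger0P (l 0 0 - l 0 1); lra.
Qed.

(** The matrix [M] comes from completing the square in [q]: it pulls
    [q] back to [16 / 9 * (X ^ 2 + Y ^ 2)], so the unit disc goes to [q <= 16 / 9]. *)
Lemma BM_dist_ball_le (q : 'rV[R]_3) : (forall t, 0 < N t 1) -> 0 < N 1 0 ->
  (forall x y, N x y ^+ 2 <= quad q x y <= 16 / 9 * N x y ^+ 2) ->
  (BM_dist K (euclidean_ball R 2) <= (4 / 3)%:E)%E.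
Proof.
move=> Npos N10 qN.
pose a := q 0 0; pose b := q 0 1; pose c := q 0 2; pose D := c - b ^+ 2 / (4 * a).
have a0 : 0 < a.
  have /andP[+ _] := qN 1 0; rewrite /quad expr0n mulr0 !mulr0 !addr0 expr1n mulr1.
  by apply: lt_le_trans; rewrite exprn_gt0.
have D0 : 0 < D.
  have /andP[+ _] := qN (- b / (2 * a)) 1.
  rewrite (_ : quad _ _ _ = D); last first.
    by rewrite /quad -/a -/b -/c /D; field; rewrite gt_eqF.
  by apply: lt_le_trans; rewrite exprn_gt0.
pose sa := Num.sqrt a; pose sD := Num.sqrt D.
have sa0 : 0 < sa by rewrite sqrtr_gt0.
have sD0 : 0 < sD by rewrite sqrtr_gt0.
have saE : sa ^+ 2 = a by rewrite sqr_sqrtr// ltW.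
have sDE : sD ^+ 2 = D by rewrite sqr_sqrtr// ltW.
pose M := mx2 (vec2 (4 / 3 / sa) 0) (vec2 (- (4 / 3) * b / (2 * a) / sD) (4 / 3 / sD)).
have ME (l : 'rV[R]_2) : quad q ((l *m M) 0 0) ((l *m M) 0 1) =
    16 / 9 * (l 0 0 ^+ 2 + l 0 1 ^+ 2).
  rewrite /M mulmx2 vec2_comb !mxE /=.
  have cE : c = sD ^+ 2 + b ^+ 2 / (4 * sa ^+ 2) by rewrite sDE saE /D subrK.
  rewrite /quad -/a -/b -/c cE -saE.
  by field; rewrite !gt_eqF.
have qnorm (x : 'rV[R]_2) : N (x 0 0) (x 0 1) <= 1 -> quad q (x 0 0) (x 0 1) <= 16 / 9.
  move=> Nx; have /andP[_ h] := qN (x 0 0) (x 0 1); apply: le_trans h _.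
  rewrite ler_piMr; [by []|by lra|].
  by rewrite expr_le1// plane_seminorm_ge0.
have Mu : M \in unitmx.
  apply: injective_unitmx => v vM0.
  have := ME v; rewrite vM0 !mxE /quad !(expr0n, mulr0, addr0) => /esym/eqP.
  rewrite mulf_eq0 paddr_eq0 ?sqr_ge0// !sqrf_eq0 => /orP[|/andP[/eqP e1 /eqP e2]].
    by rewrite gt_eqF//; lra.
  by rewrite [v]vec2E [RHS]vec2E !mxE e1 e2.
have sumE (l : 'rV[R]_2) : \sum_(i < 2) l ord0 i ^+ 2 = l 0 0 ^+ 2 + l 0 1 ^+ 2.
  by rewrite !big_ord_recl big_ord0 addr0; congr (_ + l _ _ ^+ 2); apply/val_inj.
apply: (@BM_dist_le _ _ _ _ u M) => //.
- rewrite NK => x /= Nx; exists (x *m invmx M); last by rewrite mulmxKV.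
  rewrite /euclidean_ball /= /enorm sumE -[leRHS]sqrtr1 ler_sqrt//.
  have := ME (x *m invmx M); rewrite mulmxKV//.
  have := qnorm _ Nx; lra.
- move=> l; rewrite /euclidean_ball /= /enorm sumE -[leRHS]sqrtr1 ler_sqrt// => lb.
  apply: unit_scaled; have := ME l; have /andP[+ _] := qN ((l *m M) 0 0) ((l *m M) 0 1).
  move=> h1 h2; have : N ((l *m M) 0 0) ((l *m M) 0 1) ^+ 2 <= (4 / 3) ^+ 2 by lra.
  rewrite ler_sqr// nnegrE; last lra.
  exact: plane_seminorm_ge0.
Qed.
End Bounds.

(** * The norm of a symmetric convex body *)

Lemma eq_of_le_iff (R : realFieldType) (a b : R) : 0 <= a -> 0 <= b ->
  (forall r, 0 < r -> (a <= r) = (b <= r)) -> a = b.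
Proof.
move=> a0 b0 ab; apply/eqP; rewrite eq_le; apply/andP; split.
- apply/ler_addgt0Pr => e e0; rewrite ab ?lerDl ?ltW//.
  by rewrite ltr_wpDl.
- apply/ler_addgt0Pr => e e0; rewrite -ab ?lerDl ?ltW//.
  by rewrite ltr_wpDl.
Qed.

(** [g] is the Minkowski functional of [C]. As [C] is closed, the infimum that
    defines it is attained, which gives the last clause. *)
Lemma gauge_norm (R : realType) (n : nat) (C : set 'rV[R]_n) :
  compact C -> @convex_set R 'rV[R]_n C -> (forall x, C x -> C (- x)) ->
  interior C !=set0 ->
  exists g : 'rV[R]_n -> R,
    [/\ forall k x, g (k *: x) = `|k| * g x,
        forall x y, g (x + y) <= g x + g y,
        forall x, g x = 0 -> x = 0
      & forall x, C x <-> g x <= 1].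
Proof.
move=> cptC /convex_setP cC symC [z].
rewrite /interior => /nbhs_ballP[e /= e0 ballC].
have ball0 y : `|y| < e -> C y.
  move=> ye; have : C (z + y).
    by apply: ballC; rewrite -ball_normE /= opprD addNKr normrN.
  have /symC : C (z - y).
    by apply: ballC; rewrite -ball_normE /= opprB addrCA subrr addr0.
  move=> h1 h2; have := cC _ _ (1 / 2) h1 h2.
  rewrite (_ : _ + _ = y); first by apply; lra.
  rewrite opprB scalerBr scalerDr (_ : 1 - 1 / 2 = 1 / 2 :> R); last by lra.
  by rewrite addrA subrK -scalerDl (_ : 1 / 2 + 1 / 2 = 1 :> R) ?scale1r//; lra.
have C0 : C 0 by apply: ball0; rewrite normr0.
have [B [B0 bndC]] : exists B, 0 < B /\ forall x, C x -> `|x| <= B.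
  have [M [_ MC]] := compact_bounded cptC.
  exists (`|M| + 1); split; first by rewrite ltr_wpDl.
  by move=> x Cx; apply: MC => //; apply: le_lt_trans (ler_norm M) _; rewrite ltrDl.
have closedC : closed C by apply: compact_closed cptC; exact: norm_hausdorff.
pose S x := [set r : R | 0 < r /\ C (r^-1 *: x)].
have S_ge0 x : lbound (S x) 0 by move=> r [/ltW].
have S_inf x : has_inf (S x).
  split; last by exists 0.
  exists ((`|x| + 1) / e); split; first by rewrite divr_gt0// ltr_wpDl.
  apply: ball0; rewrite normrZ gtr0_norm; last by rewrite invr_gt0 divr_gt0// ltr_wpDl.
  rewrite invf_div -mulrAC ltr_pdivrMr; last by rewrite ltr_wpDl.
  by rewrite ltr_pM2l// ltrDl.
have S_up x r r' : S x r -> r <= r' -> S x r'.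
  move=> [r0 Cr] rr'; have r'0 : 0 < r' by apply: lt_le_trans rr'.
  split=> //; have := cC _ _ (r / r') Cr C0.
  rewrite scaler0 addr0 scalerA mulrAC divff ?gt_eqF// mul1r; apply.
  exact: divr_ge0_le1 (ltW r0) r'0 rr'.
pose g x := inf (S x).
have g0 x : 0 <= g x by apply: lb_le_inf => //; case: (S_inf x).
have g_lt x r : g x < r -> S x r.
  by move=> /(inf_lt (S_inf x).1)[r' Sr' /ltW]; exact: S_up.
have gP x r : 0 < r -> C (r^-1 *: x) <-> g x <= r.
  move=> r0; split=> [Cr|gr].
    by apply: ge_inf; [case: (S_inf x)|split].
  have : s^-1 *: x @[s --> r^'+] --> r^-1 *: x.
    apply: cvgZr_tmp; apply: cvgV; first by rewrite gt_eqF.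
    exact: cvg_at_right_filter.
  apply: closed_cvg => //.
  near=> s.
  by have [] // := g_lt x s; apply: le_lt_trans gr _; near: s; exact: nbhs_right_gt.
exists g; split.
- move=> k x; have [->|k0] := eqVneq k 0.
    rewrite scale0r normr0 mul0r; apply/eqP; rewrite eq_le g0 andbT.
    apply/ler_addgt0Pr => r r0; rewrite add0r; apply/gP => //.
    by rewrite scaler0.
  have nk0 : 0 < `|k| by rewrite normr_gt0.
  apply: eq_of_le_iff => // [|r r0]; first by rewrite mulr_ge0.
  rewrite -ler_pdivlMl//.
  have rk0 : 0 < `|k|^-1 * r by rewrite mulr_gt0 ?invr_gt0.
  have rkE : (`|k|^-1 * r)^-1 *: x = `|k| *: (r^-1 *: x).
    by rewrite invfM invrK scalerA.
  have Csg y : C (`|k| *: y) <-> C (k *: y).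
    have [_|_] := ger0P k; first by [].
    by rewrite scaleNr; split=> /symC //; rewrite opprK.
  have CE : C (r^-1 *: (k *: x)) <-> C ((`|k|^-1 * r)^-1 *: x).
    by rewrite rkE Csg !scalerA mulrC.
  by apply/idP/idP => [/gP|/gP] => [/(_ r0)/CE|/(_ rk0)/CE] h; apply/gP.
- move=> x y; apply/ler_addgt0Pr => d d0.
  have d20 : 0 < d / 2 by rewrite divr_gt0.
  have [a0 Ca] : S x (g x + d / 2) by apply: g_lt; rewrite ltrDl.
  have [b0 Cb] : S y (g y + d / 2) by apply: g_lt; rewrite ltrDl.
  set a := g x + d / 2 in a0 Ca; set b := g y + d / 2 in b0 Cb.
  rewrite (_ : g x + g y + d = a + b); last by rewrite /a /b; field.
  have ab0 : 0 < a + b by exact: addr_gt0.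
  apply/gP => //; have := cC _ _ (a / (a + b)) Ca Cb.
  rewrite !scalerA (_ : a / (a + b) * a^-1 = (a + b)^-1); last first.
    by field; rewrite !gt_eqF.
  rewrite (_ : (1 - a / (a + b)) / b = (a + b)^-1); last first.
    by field; rewrite !gt_eqF.
  rewrite -scalerDr; apply.
  by apply: divr_ge0_le1; rewrite ?lerDl// ltW.
- move=> x gx; apply/eqP; rewrite -normr_eq0 eq_le normr_ge0 andbT.
  apply/ler_addgt0Pr => d d0; rewrite add0r.
  have dB0 : 0 < d / B by rewrite divr_gt0.
  have /gP : g x <= d / B by rewrite gx ltW.
  move=> /(_ dB0) /bndC; rewrite normrZ gtr0_norm ?invr_gt0// invf_div.
  by rewrite mulrAC ler_pdivrMr// ler_pM2l.
- by move=> x; have := gP x 1 ltr01; rewrite invr1 scale1r.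
Unshelve. all: by end_near.
Qed.

(** * The planar dichotomy *)

(** [d < 1363 / 1000] amounts to [Num.sqrt 2 < 13630 / 9637], which exceeds
    [Num.sqrt 2] by little more than [10 ^ -4]; the convergent [99 / 70] lies in
    between. *)
Lemma sqrt2_bounds (R : realType) : 7 / 5 < Num.sqrt 2 :> R /\
  Num.sqrt 2 < 99 / 70 :> R.
Proof.
have s0 : 0 <= Num.sqrt 2 :> R by exact: sqrtr_ge0.
have s2 : Num.sqrt 2 ^+ 2 = 2 :> R by rewrite sqr_sqrtr.
by split; rewrite -ltr_sqr ?nnegrE ?s2; lra.
Qed.

Lemma translate_convex_body (R : realType) (n : nat) (K : set 'rV[R]_n) u :
  convex_body K -> convex_body (translate u K).
Proof.
move=> [cptK /convex_setP cK [z]].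
rewrite /interior => /nbhs_ballP[e /= e0 ballK]; split.
- have ctsD : continuous (fun x : 'rV[R]_n => x + u : 'rV[R]_n).
    by move=> x; apply: continuousD; [exact: cvg_id|exact: cst_continuous].
  exact: continuous_compact (continuous_subspaceT ctsD) cptK.
- apply/convex_setP => _ _ t [x Kx <-] [y Ky <-] t01.
  exists (t *: x + (1 - t) *: y); first exact: cK.
  rewrite !scalerDr addrACA; congr (_ + _).
  by rewrite -scalerDl addrC subrK scale1r.
- exists (z + u); rewrite /interior; apply/nbhs_ballP; exists e => // y.
  rewrite -ball_normE /= => zy; exists (y - u); last by rewrite subrK.
  by apply: ballK; rewrite -ball_normE /= opprB addrA.
Qed.

Theorem corollary3p3 (R : realType) :
  let d : R := 11 * Num.sqrt 2 / (10 + Num.sqrt 2) in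
  d < 1363 / 1000 /\
  forall K : set 'rV[R]_2, convex_body K -> symmetric_body K ->
    (BM_dist K (euclidean_ball R 2) < d%:E)%E \/
    (BM_dist K (cube R 2) < d%:E)%E.
Proof.
move=> d; have [s1 s2] := sqrt2_bounds R.
have s10 : 0 < 10 + Num.sqrt 2 :> R by lra.
split; first by rewrite /d (ltr_pdivrMr _ _ s10); lra.
have d43 : 4 / 3 < d by rewrite /d (ltr_pdivlMr _ _ s10); lra.
move=> K bodyK [u symK].
have [cptC cC intC] := translate_convex_body u bodyK.
have symC x : translate u K x -> translate u K (- x).
  by move=> Cx; rewrite -symK; exists x.
have [g [gZ gD g0 gC]] := gauge_norm cptC cC symC intC.
pose N x y := g (vec2 x y).
have sN : plane_seminorm N.
  split=> [k x y|x y x' y']; rewrite /N -?gZ.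
    by congr g; have := vec2_comb k 0 x y 0 0; rewrite scale0r !mul0r !addr0.
  apply: le_trans (gD _ _); rewrite le_eqVlt; apply/orP; left; apply/eqP; congr g.
  by have := vec2_comb 1 1 x y x' y'; rewrite !scale1r !mul1r.
have N_gt0 x y : (x != 0) || (y != 0) -> 0 < N x y.
  move=> xy; rewrite lt_def plane_seminorm_ge0// andbT.
  apply: contraTneq xy => /g0/matrixP xy0.
  have := xy0 0 0; have := xy0 0 1; rewrite !mxE /= => -> ->.
  by rewrite eqxx.
have NK : translate u K = [set x | N (x 0 0) (x 0 1) <= 1].
  by apply/seteqP; split=> x; rewrite /= /N -vec2E => /gC.
have N1_gt0 t : 0 < N t 1 by apply: N_gt0; rewrite oner_neq0 orbT.
have [sq|[q qN]] := near_square_or_ellipse sN N1_gt0.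
- right; apply: le_lt_trans (BM_dist_cube_le sN NK sq) _.
  by rewrite lte_fin.
- left; apply: le_lt_trans (BM_dist_ball_le sN NK N1_gt0 _ qN) _.
    by apply: N_gt0; rewrite oner_neq0.
  by rewrite lte_fin.
Qed.
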